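(* Let $\alpha\in\{0,\frac13,\frac23\}^n$, $k,\ell\in\mathbb{N}$ with $\ell\le k$, $p,\lambda\in(0,\infty)$, $\beta\in\mathbb{R}\setminus\{1\}$, and let $f\in C^\infty(\mathbb{R}^n)$ with $|\nabla^\ell f|\in C_{\rm c}(\mathbb{R}^n)$. Then, for any $x\in\Omega^\alpha_{\lambda,\beta,k,\ell}[f]$, there exists a unique cube $Q_x\in\mathcal{D}^\alpha_{\lambda,\beta,k,\ell}[f]$ containing $x$ such that $$\sum_{Q\in\mathcal{D}^\alpha_{\lambda,\beta,k,\ell}[f]}|Q|^{p(\beta-1)}\mathbf 1_Q(x)\sim|Q_x|^{p(\beta-1)},$$ where the positive equivalence constants depend only on $n$, $p$, and $\beta$.
   Context: For $f\in L^1_{\rm loc}(\mathbb{R}^n)$ and a cube $Q$, $P_Q^{(k-1)}(f)$ is the unique polynomial of degree at most $k-1$ with $\int_Q[f(x)-P_Q^{(k-1)}(f)(x)]x^\zeta\,dx=0$ for all $\zeta\in\mathbb{Z}_+^n$ with $|\zeta|\le k-1$, and $E_k(f,Q):=\|f-P_Q^{(k-1)}(f)\|_{L^1(Q)}$. For $\alpha\in\{0,\frac13,\frac23\}^n$, $\mathcal{D}^\alpha:=\{2^j[m+[0,1)^n+(-1)^j\alpha]:j\in\mathbb{Z},m\in\mathbb{Z}^n\}$, $\mathcal{D}^\alpha_{\lambda,\beta,k,\ell}[f]:=\{Q\in\mathcal{D}^\alpha:E_k(f,Q)>\lambda|Q|^{\beta+\frac\ell n}\}$, and $\Omega^\alpha_{\lambda,\beta,k,\ell}[f]:=\bigcup_{Q\in\mathcal{D}^\alpha_{\lambda,\beta,k,\ell}[f]}Q$.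 $|\nabla^\ell f|:=[\sum_{|\zeta|=\ell}|\partial^\zeta f|^2]^{1/2}$; $C_{\rm c}$ is the set of continuous functions with compact support. $A\sim B$ means $c_1A\le B\le c_2A$ with positive constants $c_1,c_2$.
   Formalization: Uniqueness by the equivalence alone fails when np|β−1| is small; the theorem instead takes Q_x to be the largest cube of the family containing x if β>1, the smallest if β<1, and proves that this cube exists, is unique and satisfies the equivalence. *)

(* Defs.v *)
From HB Require Import structures.
From mathcomp Require Import all_boot all_order all_algebra.
From mathcomp Require Import all_classical all_reals all_analysis.
(* Not fully imported: the notations of multinomials clash with those of the
   analysis library. *)
From mathcomp Require mpoly.
Import (canonicals, coercions) mpoly.

Set Implicit Arguments.
Unset Strict Implicit.
Unset Printing Implicit Defensive.

Import Order.TTheory GRing.Theory Num.Theory.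
Import numFieldNormedType.Exports.

Local Open Scope classical_set_scope.
Local Open Scope ring_scope.

Definition measure_rV_display : measure_display -> measure_display.
Proof. exact. Qed.

Section measurable_rV.
Context (R : realType) (n : nat).

Let coords : 'I_n -> 'rV[R]_n -> measurableTypeR R := fun i x => x ord0 i.

Let rV_set0 : g_sigma_preimage coords set0.
Proof. exact: sigma_algebra0. Qed.

Let rV_setC A : g_sigma_preimage coords A -> g_sigma_preimage coords (~` A).
Proof. exact: sigma_algebraC. Qed.

Let rV_bigcup (F : (set 'rV[R]_n)^nat) :
  (forall i, g_sigma_preimage coords (F i)) ->
  g_sigma_preimage coords (\bigcup_i (F i)).
Proof. exact: sigma_algebra_bigcup. Qed.

(* The product (= Borel) sigma-algebra, as the library does for tuples. *)
HB.instance Definition _ :=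
  @isMeasurable.Build (measure_rV_display default_measure_display)
    'rV[R]_n (g_sigma_preimage coords) rV_set0 rV_setC rV_bigcup.

Lemma measurable_coord_rV (i : 'I_n) :
  measurable_fun [set: 'rV[R]_n] (fun x => x ord0 i : measurableTypeR R).
Proof.
move=> _ Y mY; rewrite setTI; apply: sub_sigma_algebra => /=.
rewrite -bigcup_seq/=; exists i => /=; first by rewrite mem_index_enum.
by exists Y => //; rewrite setTI.
Qed.

Lemma measurable_fun_rVP d (T : measurableType d) (f : T -> 'rV[R]_n) :
  measurable_fun [set: T] f <->
  forall i, measurable_fun [set: T] (fun t => f t ord0 i : measurableTypeR R).
Proof.
split=> [mf i|mf].
  exact: (measurableT_comp (measurable_coord_rV i) mf).
move=> _ A mA; rewrite setTI.
suff : g_sigma_preimage coords `<=` [set A | measurable (f @^-1` A)] by exact.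
apply: smallest_sub => /=.
- split => /=.
  + by rewrite preimage_set0.
  + by move=> B mB; rewrite setTD preimage_setC; exact: measurableC.
  + by move=> F mF; rewrite preimage_bigcup; exact: bigcupT_measurable.
- rewrite -bigcup_seq => B [i _ [C mC <-]] /=.
  by rewrite setTI -[X in measurable X]setTI; exact: mf.
Qed.

End measurable_rV.

Definition cons_rV (R : realType) (n : nat)
    (p : (measurableTypeR R * 'rV[R]_n)%type) : 'rV[R]_n.+1 :=
  \row_(i < n.+1) oapp (p.2 ord0) p.1 (unlift ord0 i).

Section lebesgue_rV_step.
Context (R : realType) (n : nat).
Local Open Scope ereal_scope.
Variable mu : {sigma_finite_measure set 'rV[R]_n -> \bar R}.

Lemma measurable_cons_rV : measurable_fun setT (@cons_rV R n).
Proof.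
apply/measurable_fun_rVP => i; rewrite /cons_rV.
case: (unliftP ord0 i) => [j|] ->.
- under eq_fun do rewrite mxE liftK /=.
  exact: (measurableT_comp (measurable_coord_rV j) measurable_snd).
- under eq_fun do rewrite mxE unlift_none /=.
  exact: measurable_fst.
Qed.

Let uncons (x : 'rV[R]_n.+1) : (measurableTypeR R * 'rV[R]_n)%type :=
  (x ord0 ord0, \row_i x ord0 (lift ord0 i))%R.

Let measurable_uncons : measurable_fun setT uncons.
Proof.
apply/measurable_fun_pairP; split.
  exact: measurable_coord_rV.
apply/measurable_fun_rVP => i /=.
by under eq_fun do rewrite mxE; exact: measurable_coord_rV.
Qed.

Let consK : cancel (@cons_rV R n) uncons.
Proof.
move=> [x v]; rewrite /uncons /cons_rV mxE unlift_none /=; congr pair.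
by apply/rowP => i; rewrite !mxE liftK.
Qed.

Definition lebesgue_rV_step : set 'rV[R]_n.+1 -> \bar R :=
  pushforward (lebesgue_measure \x mu) (@cons_rV R n).

Let step0 : lebesgue_rV_step set0 = 0.
Proof. by rewrite /lebesgue_rV_step /pushforward preimage_set0 measure0. Qed.

Let step_ge0 A : 0 <= lebesgue_rV_step A.
Proof. by rewrite /lebesgue_rV_step /pushforward; apply: measure_ge0. Qed.

Let step_sigma_additive : semi_sigma_additive lebesgue_rV_step.
Proof.
move=> F mF tF mUF; rewrite /lebesgue_rV_step /pushforward preimage_bigcup.
apply: measure_semi_sigma_additive.
- by move=> i; rewrite -[X in measurable X]setTI; exact: measurable_cons_rV.
- apply/trivIsetP => /= i j _ _ ij; rewrite -preimage_setI.
  by move/trivIsetP : tF => /(_ _ _ _ _ ij) ->//; rewrite preimage_set0.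
- by rewrite -preimage_bigcup -[X in measurable X]setTI;
    exact: measurable_cons_rV.
Qed.

HB.instance Definition _ := isMeasure.Build _ _ _
  lebesgue_rV_step step0 step_ge0 step_sigma_additive.

Let step_sigma_finite : sigma_finite setT lebesgue_rV_step.
Proof.
have /sigma_finiteP[F [TF ndF Foo]] :=
  sigma_finiteT (@lebesgue_measure R : {sigma_finite_measure set _ -> \bar R}).
have /sigma_finiteP[G [TG ndG Goo]] := sigma_finiteT mu.
exists (fun i => uncons @^-1` (F i `*` G i)).
  rewrite -preimage_bigcup (_ : \bigcup_i _ = setT) ?preimage_setT//.
  rewrite -setXTT TF TG predeqE => -[x y]; split.
    by move=> [i _ []/= ? ?]; split; exists i.
  move=> [/= [i _ Fix_] [j _ Gjy]]; exists (maxn i j) => //; split.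
  - by move: x Fix_; exact/subsetPset/ndF/leq_maxl.
  - by move: y Gjy; exact/subsetPset/ndG/leq_maxr.
move=> i; have [mF Fi] := Foo i; have [mG Gi] := Goo i; split.
  rewrite -[X in measurable X]setTI; apply: measurable_uncons => //.
  exact: measurableX.
rewrite /lebesgue_rV_step /pushforward.
rewrite -comp_preimage (_ : _ \o _ = id); last exact/funext/consK.
by rewrite /= product_measure1E// lte_mul_pinfty// ge0_fin_numE.
Qed.

HB.instance Definition _ := Measure_isSigmaFinite.Build _ _ _
  lebesgue_rV_step step_sigma_finite.

End lebesgue_rV_step.

(* Lebesgue measure on R^0 is the unit mass; on R^(n+1) it is the image of the
   product of the Lebesgue measures on R and R^n under (t, v) |-> (t, v). *)
Fixpoint lebesgue_rV (R : realType) (n : nat) :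
    {sigma_finite_measure set 'rV[R]_n -> \bar R} :=
  match n return {sigma_finite_measure set 'rV[R]_n -> \bar R} with
  | 0 => \d_(0 : 'rV[R]_0)
  | m.+1 => lebesgue_rV_step (lebesgue_rV R m)
  end.
Arguments lebesgue_rV : clear implicits.

Definition vol (R : realType) (n : nat) (Q : set 'rV[R]_n) : R :=
  fine (lebesgue_rV R n Q).

Section derivatives.
Context (R : realType) (n : nat).
Implicit Type f : 'rV[R]_n -> R.

Definition partial (i : 'I_n) f : 'rV[R]_n -> R :=
  fun x => 'D_(delta_mx ord0 i) f x.

(* C^oo: the iterated partial derivatives of all orders, in any order of
   differentiation, exist everywhere and are continuous.  The existence clause
   matters because ['D_v f] is a total function. *)
Definition smooth f : Prop := forall s : seq 'I_n,
  continuous (foldr partial f s) /\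
  forall (i : 'I_n) (x : 'rV[R]_n),
    derivable (foldr partial f s) x (delta_mx ord0 i).

Definition mpartial (zeta : mpoly.multinom n) f : 'rV[R]_n -> R :=
  foldr (fun i g => iter (mpoly.fun_of_multinom zeta i) (partial i) g)
    f (enum 'I_n).

(* [mpoly.bmultinom n l.+1] is the finite type of multi-indices of degree at
   most [l]. *)
Definition grad_norm (l : nat) f : 'rV[R]_n -> R := fun x =>
  Num.sqrt (\sum_(zeta : mpoly.bmultinom n l.+1
                  | mpoly.mdeg (mpoly.bmnm zeta) == l)
              mpartial (mpoly.bmnm zeta) f x ^+ 2).

Definition continuous_compact_support (g : 'rV[R]_n -> R) : Prop :=
  continuous g /\ compact (closure [set x | g x != 0]).

End derivatives.

Section approximation.
Context (R : realType) (n : nat).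
Local Open Scope ereal_scope.
Local Notation mu := (lebesgue_rV R n).
Implicit Types (f : 'rV[R]_n -> R) (Q : set 'rV[R]_n).

(* [mpoly.msize P <= k] means that [P] has total degree at most [k - 1]. *)
Definition is_poly_proj (k : nat) f Q (P : mpoly.mpoly n R) : Prop :=
  (mpoly.msize P <= k)%N /\
  forall zeta : mpoly.multinom n, (mpoly.mdeg zeta < k)%N ->
    \int[mu]_(x in Q) ((f x - mpoly.meval (x ord0) P)
                       * mpoly.mmap1 (x ord0) zeta)%:E = 0.

Definition poly_proj (k : nat) f Q : mpoly.mpoly n R :=
  xget 0%R [set P | is_poly_proj k f Q P].

Definition approx_err (k : nat) f Q : \bar R :=
  \int[mu]_(x in Q) `|f x - mpoly.meval (x ord0) (poly_proj k f Q)|%:E.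

End approximation.

Section dyadic.
Context (R : realType) (n : nat).

Definition dyadic_cube (alpha : 'rV[R]_n) (j : int) (m : 'rV[int]_n) :
    set 'rV[R]_n :=
  [set (2 : R) ^ j *: (map_mx intr m + u + (-1 : R) ^ j *: alpha)
     | u in [set u : 'rV[R]_n | forall i, 0 <= u ord0 i < 1]].

Definition dyadic (alpha : 'rV[R]_n) : set (set 'rV[R]_n) :=
  [set Q | exists j m, Q = dyadic_cube alpha j m].

Definition bad_dyadic (alpha : 'rV[R]_n) (lambda beta : R) (k l : nat)
    (f : 'rV[R]_n -> R) : set (set 'rV[R]_n) :=
  [set Q | dyadic alpha Q /\
     ((lambda * vol Q `^ (beta + l%:R / n%:R))%:E < approx_err k f Q)%E].

Definition bad_set (alpha : 'rV[R]_n) (lambda beta : R) (k l : nat)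
    (f : 'rV[R]_n -> R) : set 'rV[R]_n :=
  \bigcup_(Q in bad_dyadic alpha lambda beta k l f) Q.

(* The cubes of [DD] containing [x] form a chain along which [vol Q] grows
   geometrically.  The sum of the powers [vol Q `^ (p * (beta - 1))] over this
   chain is comparable to each term with a constant depending on the term, so
   comparability alone does not single out a cube: the intended one is the
   largest cube of the chain if [1 < beta], the smallest if [beta < 1]. *)
Definition extremal_cube (beta : R) (DD : set (set 'rV[R]_n))
    (x : 'rV[R]_n) (Q : set 'rV[R]_n) : Prop :=
  (1 < beta -> forall Q', DD Q' -> Q' x -> Q' `<=` Q) /\
  (beta < 1 -> forall Q', DD Q' -> Q' x -> Q `<=` Q').

End dyadic.

Definition equiv_up_to (R : realType) (c1 c2 : R) (A B : \bar R) : Prop :=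
  (c1%:E * A <= B /\ B <= c2%:E * A)%E.

(* Main.v *)
Require Import Defs.
From mathcomp Require Import all_boot all_order all_algebra.
From mathcomp Require Import all_classical all_reals all_analysis.
From mathcomp Require Import ring lra zify.
From mathcomp Require mpoly.
Import (canonicals, coercions) mpoly.

Set Implicit Arguments.
Unset Strict Implicit.
Unset Printing Implicit Defensive.

Import Order.TTheory GRing.Theory Num.Theory.
Import numFieldNormedType.Exports.

Local Open Scope classical_set_scope.
Local Open Scope ring_scope.

(** The approximation error obeys [approx_err k f Q <= C * |Q|^(1 + l/n)] for
    every cube [Q], with a constant [C] depending on [f] but not on [Q]
    ([approx_err_dyadic_le]). Comparing this with the definition of a bad cube,
    [lambda * |Q|^(beta + l/n) < approx_err k f Q], gives
    [|Q|^(beta - 1) < C / lambda]: the scales of bad cubes are bounded above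
    if [1 < beta] and bounded below if [beta < 1]
    ([bad_dyadic_scale_bound]). Dyadic cubes through a fixed point [x] form a
    chain indexed by the scale, because [3 * alpha] has integer coordinates
    ([dyadic_cube_at_mono]); so among the bad cubes containing [x] there is a
    largest one, respectively a smallest one, and this is [Qx]. Along the chain
    [|Q|^(p(beta - 1))] decays geometrically away from [Qx], with ratio
    [r = 2^(- n p |beta - 1|)], so the sum lies between the term of [Qx] and
    [1 / (1 - r)] times that term ([esum_geometric_le]). Uniqueness is
    antisymmetry of inclusion.

    The error bound has two ingredients.

    The derivatives of order [l] are bounded, being dominated by the continuous
    compactly supported [grad_norm l f]; hence near any point [f] is within
    [C r^l] of a polynomial of degree [< l] ([taylor_smooth]). That polynomial
    is built one coordinate at a time, in the order in which [mpartial]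
    differentiates, so that the remainders are derivatives occurring in
    [grad_norm l f].

    The polynomial [poly_proj k f Q] is an orthogonal projection of [f] in
    [L^2(Q)]; it exists because the moment equations are a linear system whose
    Gram matrix is positive semidefinite
    ([orthogonal_projection_exists]). If [T] has degree [< k], Pythagoras and
    Cauchy-Schwarz give
    [||f - P||_1 <= |Q|^(1/2) ||f - P||_2 <= |Q|^(1/2) ||f - T||_2
       <= |Q| sup_Q |f - T|] ([approx_err_le]). *)

(** * Taylor's formula in one variable *)

Section Taylor1D.
Context (R : realType).

Lemma norm_le_of_derive_le (g dg : R -> R) (t B : R) :
  (forall u, is_derive u (1 : R) g (dg u)) ->
  (forall u, `|u| <= `|t| -> `|dg u| <= B) ->
  `|g t - g 0| <= B * `|t|.
Proof.
move=> gd dgB.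
have gc : continuous g.
  move=> u; apply: differentiable_continuous; apply/derivable1_diffP.
  by have [] := gd u.
have [t0|t0|->] := ltgtP t 0; last by rewrite subrr !normr0 mulr0.
- have [c + E] := MVT t0 (fun u _ => gd u) (continuous_subspaceT gc).
  rewrite in_itv /= => /andP[tc c0].
  rewrite distrC E normrM sub0r normrN ler_wpM2r// dgB//.
  by rewrite !ltr0_norm// lerN2 ltW.
- have [c + E] := MVT t0 (fun u _ => gd u) (continuous_subspaceT gc).
  rewrite in_itv /= => /andP[tc c0].
  rewrite E normrM subr0 ler_wpM2r// dgB//.
  by rewrite !gtr0_norm// ltW.
Qed.

(** Taylor's bound without the factor [1 / m!], for which induction on the order
    and the mean value inequality suffice: the remainder of order [m + 1] has
    the remainder of order [m] of the derivative as its derivative. The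
    derivatives are given as a sequence of functions so that the lemma applies
    to restrictions of partial derivatives to lines. *)
Lemma taylor1D (m : nat) (phi : nat -> R -> R) (M t : R) :
  (forall q u, (q < m)%N -> is_derive u (1 : R) (phi q) (phi q.+1 u)) ->
  (forall u, `|phi m u| <= M) ->
  `|phi 0%N t - \sum_(q < m) phi q 0 * t ^+ q / q`!%:R| <= M * `|t| ^+ m.
Proof.
elim: m phi M t => [|m IH] phi M t dphi Mphi.
  by rewrite big_ord0 subr0 expr0 mulr1.
pose g u := phi 0%N u - \sum_(q < m.+1) phi q 0 * u ^+ q / q`!%:R.
pose dg u := phi 1%N u - \sum_(q < m) phi q.+1 0 * u ^+ q / q`!%:R.
have g0 : g 0 = 0.
  rewrite /g big_ord_recl /= expr0 mulr1 divr1 big1 ?addr0 ?subrr// => i _.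
  by rewrite expr0n /= mulr0 mul0r.
have gd u : is_derive u (1 : R) g (dg u).
  rewrite /g /dg; apply: is_deriveB; first exact: dphi.
  rewrite (_ : (fun u => _) =
      \sum_(q < m.+1) (fun u : R => phi q 0 / q`!%:R * u ^+ q)); last first.
    apply/funext => v; rewrite fct_sumE.
    by apply: eq_bigr => q _; rewrite mulrAC.
  rewrite (_ : \sum_(q < m) _ = \sum_(q < m.+1)
      (phi q 0 / q`!%:R *: ((q%:R * u ^+ q.-1) *: (1 : R)))).
    apply: is_derive_sum => q.
    rewrite (_ : (fun v => _) = (phi q 0 / q`!%:R) \*: (id ^+ q : R -> R)).
      exact: is_deriveZ.
    by apply/funext => v; rewrite /= exprfctE.
  rewrite big_ord_recl /= mul0r scale0r scaler0 add0r; apply: eq_bigr => q _.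
  rewrite /= /bump /= add1n factS natrM /GRing.scale /=; field.
  by rewrite nat1r !pnatr_eq0 /= -lt0n fact_gt0.
rewrite -/(g t) -[g t]subr0 -g0 exprSr mulrA.
apply: norm_le_of_derive_le gd _ => u ut; rewrite /dg.
apply: le_trans (IH (fun q => phi q.+1) M u _ Mphi) _.
  by move=> q v qm; exact: dphi.
rewrite ler_wpM2l//; first by rewrite (le_trans _ (Mphi 0)).
by rewrite lerXn2r// ?nnegrE.
Qed.

End Taylor1D.

(** * Multivariate polynomials *)

Section MultivariatePolynomials.
Context (R : realType) (n : nat).

Lemma msize_mulX (i : 'I_n) (c : R) (q m : nat) (T : mpoly.mpoly n R) :
  (mpoly.msize T <= m)%N ->
  (mpoly.msize ((mpoly.mpolyX R (mpoly.mnm1 i) - mpoly.mpolyC n c) ^+ q * T)%R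
    <= q + m)%N.
Proof.
move=> Tm; elim: q => [|q IH]; first by rewrite expr0 mul1r.
rewrite exprS -mulrA; set L := (_ - _)%R; set S := (_ * T)%R in IH *.
have [->|L0] := eqVneq L 0; first by rewrite mul0r mpoly.msize0.
have [->|S0] := eqVneq S 0; first by rewrite mulr0 mpoly.msize0.
rewrite mpoly.msizeM//.
suff L2 : (mpoly.msize L <= 2)%N.
  by rewrite -[leqRHS]/(2 + (q + m)).-1 -!subn1 leq_sub2r// leq_add.
rewrite (leq_trans (mpoly.msizeD_le _ _))// geq_max mpoly.msizeN mpoly.msizeX.
by rewrite mpoly.mdeg1 mpoly.msizeC; case: (c != 0).
Qed.

Lemma meval_continuous (T : mpoly.mpoly n R) :
  continuous (fun x : 'rV[R]_n => mpoly.meval (x ord0) T).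
Proof.
under eq_fun do rewrite mpoly.mevalE.
apply: continuous_big; first exact: add_continuous.
move=> m _ x; apply: (@continuousM _ _ (cst _)); first exact: cst_continuous.
move: x; apply: continuous_big; first exact: mul_continuous.
move=> i _ x.
apply: (@continuous_comp _ R R (fun y : 'rV[R]_n => y ord0 i)
  (fun u => u ^+ m i)).
  exact: coord_continuous.
exact: exprn_continuous.
Qed.

End MultivariatePolynomials.

(** * Taylor's formula in several variables *)

Section TaylorND.
Context (R : realType) (n : nat).
Implicit Types (g : 'rV[R]_n -> R) (a x : 'rV[R]_n).

Lemma smooth_partial g i : smooth g -> smooth (partial i g).
Proof. by move=> sg s; rewrite -foldr_rcons; exact: sg. Qed.

Lemma smooth_iter_partial g i q : smooth g -> smooth (iter q (partial i) g).
Proof.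
by move=> sg; elim: q => [|q IH]; [exact: sg|exact: smooth_partial].
Qed.

Lemma is_derive_line g i y (t : R) : smooth g ->
  is_derive t (1 : R) (fun u => g (u *: delta_mx ord0 i + y))
    (partial i g (t *: delta_mx ord0 i + y)).
Proof.
move=> sg; have [_ /(_ i (t *: delta_mx ord0 i + y)) dg] := sg [::].
set e := delta_mx _ _ in dg *.
pose line (u : R) := g (u *: e + y).
have E : (fun h : R => h^-1 *: ((line \o shift t) (h *: (1 : R)) - line t)) =
    (fun h => h^-1 *: ((g \o shift (t *: e + y)) (h *: e) - g (t *: e + y))).
  by apply/funext => h /=; rewrite /line [_ *: 1]mulr1 scalerDl addrA.
apply: DeriveDef; first by rewrite /derivable E.
by rewrite /partial /derive E.
Qed.

(** The projection of [x] on the coordinate plane through [a] in the directions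
    of [s]. *)
Definition clamp a (s : seq 'I_n) x : 'rV[R]_n :=
  \row_j if j \in s then x ord0 j else a ord0 j.

(** [mpartial] along a list of coordinates: the last coordinate of [s] is
    differentiated first, which is the order in which [taylorND] consumes
    them. *)
Definition partials (zeta : 'I_n -> nat) g (s : seq 'I_n) :=
  foldr (fun i h => iter (zeta i) (partial i) h) g s.

Lemma eq_partials zeta zeta' g s : {in s, zeta =1 zeta'} ->
  partials zeta g s = partials zeta' g s.
Proof.
elim: s => //= i s IH zz; rewrite zz ?mem_head// IH// => j js.
by rewrite zz// in_cons js orbT.
Qed.

Lemma partials0 g s : partials (fun=> 0%N) g s = g.
Proof. by elim: s. Qed.

(** The coordinates of [s] are freed one by one, the last one first: expand [g]
    along the direction [i], starting from the point with that coordinate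
    clamped at [a], and apply the induction hypothesis to the coefficients, the
    pure derivatives [iter q (partial i) g] with [q < m], up to the order
    [m - q]. All the remainders then are derivatives [partials zeta g s] with
    [zeta] of total order [m]. Here [C] must not depend on [a], [g] or [M]. *)
Lemma taylorND (s : seq 'I_n) : uniq s -> forall m : nat,
  exists2 C : R, 0 <= C & forall g (M : R) a, smooth g -> 0 <= M ->
    (forall zeta, (\sum_(i <- s) zeta i)%N = m ->
       forall y, `|partials zeta g s y| <= M) ->
  exists2 T : mpoly.mpoly n R, (mpoly.msize T <= m)%N &
    forall x r, 0 <= r -> (forall i, `|x ord0 i - a ord0 i| <= r) ->
      `|g (clamp a s x) - mpoly.meval (x ord0) T| <= C * M * r ^+ m.
Proof.
elim/last_ind: s => [_ m|s i IH].
  exists 1 => // g M a sg M0 gM; case: m gM => [|m] gM.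
    exists 0 => [|x r r0 xr]; first by rewrite mpoly.msize0.
    rewrite mpoly.meval0 subr0 mul1r mulr1.
    by apply: (gM (fun=> 0%N)); rewrite big_nil.
  exists (mpoly.mpolyC n (g a)) => [|x r r0 xr].
    by rewrite mpoly.msizeC; case: (_ != _).
  rewrite mpoly.mevalC (_ : clamp a [::] x = a) ?subrr ?normr0.
    by rewrite !mulr_ge0 ?exprn_ge0.
  by apply/rowP => j; rewrite mxE.
rewrite rcons_uniq => /andP[i_s us] m.
have [C CP] := choice (fun k => let: ex_intro2 c c0 cP := IH us k in
  ex_intro (fun c => _ /\ _) c (conj c0 cP)).
exists (1 + \sum_(q < m) C (m - q)%N).
  by rewrite addr_ge0// sumr_ge0// => q _; have [] := CP (m - q)%N.
move=> g M a sg M0 gM.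
have /choice[T TP] (q : 'I_m) : exists Tq : mpoly.mpoly n R,
   (mpoly.msize Tq <= m - q)%N /\
    forall x r, 0 <= r -> (forall i, `|x ord0 i - a ord0 i| <= r) ->
      `|iter q (partial i) g (clamp a s x) - mpoly.meval (x ord0) Tq|
        <= C (m - q)%N * M * r ^+ (m - q).
  have [_ /(_ (iter q (partial i) g) M a)] := CP (m - q)%N.
  case; [exact: smooth_iter_partial|by []| |by move=> T T1 T2; exists T].
  move=> zeta zm y.
  have := gM (fun j => if j == i then q : nat else zeta j) _ y.
  rewrite /partials foldr_rcons eqxx -!/(partials _ _ _).
  rewrite (@eq_partials _ zeta) => [|j js]; last first.
    by case: eqP => // ji; rewrite ji (negPf i_s) in js.
  apply; rewrite -cats1 big_cat /= big_seq1 eqxx (eq_big_seq zeta) => [|j js].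
    by rewrite zm subnK// ltnW.
  by case: eqP => // ji; rewrite ji (negPf i_s) in js.
exists (\sum_(q < m) q`!%:R^-1 *:
  ((mpoly.mpolyX R (mpoly.mnm1 i) - mpoly.mpolyC n (a ord0 i)) ^+ q * T q)).
  rewrite (leq_trans (mpoly.msize_sum _ _ _))//; apply/bigmax_leqP => q _.
  rewrite (leq_trans (mpoly.msizeZ_le _ _))//.
  have [/(msize_mulX i (a ord0 i) q)/leq_trans-> //] := TP q.
  by rewrite subnKC// ltnW.
move=> x r r0 xr; set t := x ord0 i - a ord0 i; set y := clamp a s x.
pose phi q (u : R) := iter q (partial i) g (u *: delta_mx ord0 i + y).
have -> : g (clamp a (rcons s i) x) = phi 0%N t.
  congr g; apply/rowP => j; rewrite !mxE eqxx /= mem_rcons in_cons.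
  case: eqP => [->|_] /=; last by rewrite mulr0 add0r.
  by rewrite (negPf i_s) mulr1 subrK.
have phi0 q : phi q 0 = iter q (partial i) g y.
  by rewrite /phi scale0r add0r.
have := @taylor1D R m phi M t _ _.
have /[swap] /[apply] : forall q u, (q < m)%N ->
    is_derive u (1 : R) (phi q) (phi q.+1 u).
  by move=> q u _; apply: is_derive_line; exact: smooth_iter_partial.
have /[swap] /[apply] : forall u, `|phi m u| <= M.
  move=> u; have := gM (fun j => if j == i then m : nat else 0%N) _
    (u *: delta_mx ord0 i + y).
  rewrite /partials foldr_rcons eqxx -!/(partials _ _ _).
  rewrite (@eq_partials _ (fun=> 0%N)) => [|j js]; last first.
    by case: eqP => // ji; rewrite ji (negPf i_s) in js.
  rewrite partials0; apply.
  rewrite -cats1 big_cat /= big_seq1 eqxx big_seq big1// => j js.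
  by case: eqP => // ji; rewrite ji (negPf i_s) in js.
move=> taylor; rewrite (raddf_sum (mpoly.meval (x ord0))) /=.
set S := \sum_(q < m) _ in taylor; rewrite -[phi 0%N t](subrK S) -addrA.
rewrite (le_trans (ler_normD _ _))// mulrDl mulrDl lerD//.
  rewrite mul1r (le_trans taylor)// ler_wpM2l// lerXn2r ?nnegrE//.
  exact: xr.
rewrite /S -sumrB !mulr_suml (le_trans (ler_norm_sum _ _ _))// ler_sum// => q _.
rewrite mpoly.mevalZ mpoly.mevalM rmorphXn /=.
rewrite mpoly.mevalB mpoly.mevalXU mpoly.mevalC.
rewrite -/t phi0; have [_ /(_ x r r0 xr)] := TP q; rewrite -/y.
set c := q`!%:R^-1; set u := iter _ _ _ _; set v := mpoly.meval _ _ => uv.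
have -> : u * t ^+ q * c - c * (t ^+ q * v) = t ^+ q * (c * (u - v)) by ring.
have c01 : 0 <= c <= 1.
  by rewrite invr_ge0 ler0n invf_le1 ?ler1n ?ltr0n ?fact_gt0.
have -> : r ^+ m = r ^+ (m - q) * r ^+ q by rewrite -exprD subnK// ltnW.
rewrite [leRHS]mulrA [leRHS]mulrC !normrM.
rewrite ler_pM// ?mulr_ge0//; last first.
  by rewrite (le_trans _ uv)// ler_piMl// ger0_norm//; case/andP: c01.
by rewrite normrX lerXn2r ?nnegrE// xr.
Qed.

End TaylorND.

Section BoundedGradient.
Context (R : realType) (n : nat).
Implicit Types (f : 'rV[R]_n -> R).

Lemma compact_support_bounded f : continuous_compact_support f ->
  exists2 M : R, 0 <= M & forall x, `|f x| <= M.
Proof.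
move=> [fc cK].
have /compact_bounded[M0 [_ MP]] :=
  continuous_compact (continuous_subspaceT fc) cK.
exists (`|M0| + 1) => [|x]; first by rewrite addr_ge0.
have [->|fx0] := eqVneq (f x) 0; first by rewrite normr0 addr_ge0.
apply: MP; first by rewrite ltr_pwDr// ler_norm.
by exists x => //; exact: subset_closure.
Qed.

Lemma mpartial_le_grad_norm f (l : nat) (zeta : mpoly.multinom n) x :
  mpoly.mdeg zeta = l -> `|mpartial zeta f x| <= grad_norm l f x.
Proof.
move=> zl; have zl1 : (mpoly.mdeg zeta < l.+1)%N by rewrite zl.
rewrite -sqrtr_sqr ler_wsqrtr// (bigD1 (mpoly.BMultinom zl1)) /= ?zl//.
by rewrite lerDl sumr_ge0// => i _; rewrite sqr_ge0.
Qed.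

Lemma taylor_smooth f (l : nat) : smooth f ->
  continuous_compact_support (grad_norm l f) ->
  exists2 C : R, 0 <= C & forall a : 'rV[R]_n,
    exists2 T : mpoly.mpoly n R, (mpoly.msize T <= l)%N &
      forall (x : 'rV[R]_n) r, 0 <= r ->
        (forall i, `|x ord0 i - a ord0 i| <= r) ->
        `|f x - mpoly.meval (x ord0) T| <= C * r ^+ l.
Proof.
move=> sf /compact_support_bounded[M M0 fM].
have [C C0 CP] := taylorND R (enum_uniq 'I_n) l.
exists (C * M) => [|a]; first exact: mulr_ge0.
have [zeta zl y|T Tl TP] := CP f M a sf M0.
  rewrite (le_trans _ (fM y))// (le_trans _ (ler_norm _))//.
  have -> : partials zeta f (enum 'I_n) =
      mpartial (mpoly.Multinom [tuple zeta i | i < n]) f.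
    by apply: eq_partials => i _; rewrite mpoly.mnmE.
  apply: mpartial_le_grad_norm.
  rewrite mpoly.mdegE -zl big_enum; apply: eq_bigr => i _.
  by rewrite mpoly.mnmE.
exists T => // x r r0 /(TP x r r0); rewrite (_ : clamp _ _ x = x)//.
by apply/rowP => j; rewrite mxE mem_enum.
Qed.

End BoundedGradient.

(** * Measurability of continuous functions on [R^n] *)

Section MeasurableRV.
Context (R : realType) (n : nat).

Definition open_box (a b : 'rV[R]_n) : set 'rV[R]_n :=
  [set y | forall i, a ord0 i < y ord0 i < b ord0 i].

Lemma measurable_coords (A : 'I_n -> set (measurableTypeR R)) :
  (forall i, measurable (A i)) ->
  measurable [set y : 'rV[R]_n | forall i, A i (y ord0 i)].
Proof.
move=> mA; rewrite (_ : mkset _ =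
  \bigcap_(i in [set: 'I_n]) ((fun y : 'rV[R]_n => y ord0 i) @^-1` A i)).
  apply: fin_bigcap_measurable => [|i _]; first exact: finite_finset.
  by rewrite -[X in measurable X]setTI; exact: measurable_coord_rV.
by apply/seteqP; split=> y /= yA i; [move=> _|]; exact: yA.
Qed.

Lemma measurable_open_box a b : measurable (open_box a b).
Proof.
apply: (@measurable_coords (fun i => [set` `]a ord0 i, b ord0 i[])) => i.
exact: measurable_itv.
Qed.

(** The sigma-algebra is generated by the coordinates; an open set is the union
    of the boxes with rational corners that it contains, which are countably
    many. *)
Lemma open_measurable_rV (U : set 'rV[R]_n) : open U -> measurable U.
Proof.
move=> oU.
pose box (c : ('rV[rat]_n * 'rV[rat]_n)%type) :=
  open_box (map_mx ratr c.1) (map_mx ratr c.2).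
have -> : U = \bigcup_c (if `[< box c `<=` U >] then box c else set0).
  apply/seteqP; split=> [x Ux|x [c _]]; last first.
    by case: asboolP => // cU; exact: cU.
  have /nbhs_ballP[e /= e0 xeU] := open_nbhs_nbhs (conj oU Ux).
  have /choice[a aP] i : exists q, ratr q \in `]x ord0 i - e, x ord0 i[.
    by apply: rat_in_itvoo; rewrite ltrBlDr ltrDl.
  have /choice[b bP] i : exists q, ratr q \in `]x ord0 i, x ord0 i + e[.
    by apply: rat_in_itvoo; rewrite ltrDl.
  exists (\row_i a i, \row_i b i) => //; case: asboolP => [_ i|[]].
    by have := aP i; have := bP i; rewrite !mxE !in_itv /=; lra.
  move=> y /= yab; apply: xeU; split => // i j; rewrite (ord1 i).
  have := yab j; have := aP j; have := bP j; rewrite !mxE !in_itv /= /ball /=.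
  by rewrite ltr_norml; lra.
apply: countable_bigcupT_measurable => // c.
case: ifP => _ //; exact: measurable_open_box.
Qed.

Lemma continuous_measurable_rV (f : 'rV[R]_n -> R) :
  continuous f -> measurable_fun setT (f : 'rV[R]_n -> measurableTypeR R).
Proof.
move=> /continuousP cf.
apply: (measurability _ (measurable_realfun.RGenOpens.measurableE R)).
move=> _ [_ [a [b ->] <-]]; rewrite setTI; apply: open_measurable_rV.
exact/cf/interval_open.
Qed.

End MeasurableRV.

(** * Volume of cubes and integrability on cubes *)

Definition cube (R : realType) (n : nat) (c : 'rV[R]_n) (s : R) :
    set 'rV[R]_n :=
  [set y | forall i, c ord0 i <= y ord0 i < c ord0 i + s].

Section Cubes.
Context (R : realType).

Lemma measurable_cube n (c : 'rV[R]_n) s : measurable (cube c s).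
Proof.
apply: (@measurable_coords _ _
  (fun i => [set` `[c ord0 i, c ord0 i + s[])) => i.
exact: measurable_itv.
Qed.

Lemma lebesgue_cube n (c : 'rV[R]_n) s : 0 <= s ->
  lebesgue_rV R n (cube c s) = (s ^+ n)%:E.
Proof.
move=> s0; elim: n c => [|n IH] c.
  rewrite /= diracE expr0 mem_set//; by case.
pose c' : 'rV[R]_n := \row_i c ord0 (lift ord0 i).
rewrite [LHS](_ : _ = (lebesgue_measure \x lebesgue_rV R n)%E
    (`[c ord0 ord0, c ord0 ord0 + s[ `*` cube c' s)).
  rewrite product_measure1E//; last exact: measurable_cube.
  rewrite IH [X in (X * _)%E]lebesgue_measure_itv /= lte_fin ltrDl.
  have [s0'|] := ltP 0 s.
    by rewrite -EFinB -EFinM addrAC subrr add0r exprS.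
  by move=> s0'; rewrite mul0e (_ : s = 0) ?expr0n//; lra.
congr (product_measure1 _ _ _); apply/seteqP; split => -[t v] /=.
  move=> cv; split=> [|i].
    by have := cv ord0; rewrite /cons_rV mxE unlift_none /= in_itv.
  by have := cv (lift ord0 i); rewrite /cons_rV !mxE liftK.
move=> [ct cv] i; rewrite /cons_rV mxE.
case: (unliftP ord0 i) => [j|] -> /=; last by rewrite in_itv in ct.
by have := cv j; rewrite !mxE.
Qed.

Lemma continuous_bounded_cube n (f : 'rV[R]_n -> R) c s : continuous f ->
  [bounded f x | x in cube c s].
Proof.
move=> fc.
have cK : compact [set y : 'rV[R]_n |
    forall i, `[c ord0 i, c ord0 i + s]%classic (y ord0 i)].
  apply: (@rV_compact R n (fun i => `[c ord0 i, c ord0 i + s]%classic)) => i.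
  exact: segment_compact.
have [M [Mr MP]] :=
  compact_bounded (continuous_compact (continuous_subspaceT fc) cK).
exists M; split => // N MN y cy; apply: MP MN _ _; exists y => // i.
by have /andP[cy1 /ltW cy2] := cy i; rewrite /= in_itv /= cy1 cy2.
Qed.

Lemma continuous_integrable_cube n (f : 'rV[R]_n -> R) c s : 0 <= s ->
  continuous f -> (lebesgue_rV R n).-integrable (cube c s) (EFin \o f).
Proof.
move=> s0 fc; apply: measurable_bounded_integrable.
- exact: measurable_cube.
- by rewrite [X in (X < _)%E]lebesgue_cube// ltry.
- by apply: measurable_funTS; exact: continuous_measurable_rV.
- exact: continuous_bounded_cube.
Qed.

End Cubes.

(** * Polynomial projections and the approximation error *)

Section Projection.
Context (R : realType) (n : nat) (c : 'rV[R]_n) (s : R) (s0 : 0 <= s).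
Implicit Types f g h : 'rV[R]_n -> R.
Local Notation mu := (lebesgue_rV R n).
Local Notation Q := (cube c s).
Local Notation I f := (\int[mu]_(x in Q) f x).

Let contD f g : continuous f -> continuous g -> continuous (fun x => f x + g x).
Proof. by move=> cf cg x; apply: continuousD; [exact: cf|exact: cg]. Qed.

Let contM f g : continuous f -> continuous g -> continuous (fun x => f x * g x).
Proof. by move=> cf cg x; apply: continuousM; [exact: cf|exact: cg]. Qed.

Let contZ a f : continuous f -> continuous (fun x => a * f x).
Proof. by move=> cf; apply: contM => //; exact: cst_continuous. Qed.

Let cont_sum N (e : 'I_N -> 'rV[R]_n -> R) : (forall i, continuous (e i)) ->
  continuous (fun x => \sum_i e i x).
Proof.
move=> ce; apply: continuous_big => [|i _]; last exact: ce.
exact: add_continuous.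
Qed.

Let cont_integrable f : continuous f -> mu.-integrable Q (EFin \o f).
Proof. exact: continuous_integrable_cube. Qed.

Let measQ : measurable Q. Proof. exact: measurable_cube. Qed.

Let intZ a f : continuous f -> I (fun x => a * f x) = a * I f.
Proof. by move=> cf; apply: RintegralZl => //; exact: cont_integrable. Qed.

Let intD f g : continuous f -> continuous g ->
  I (fun x => f x + g x) = I f + I g.
Proof. by move=> cf cg; apply: RintegralD => //; exact: cont_integrable. Qed.

Let int_sum N (e : 'I_N -> 'rV[R]_n -> R) : (forall i, continuous (e i)) ->
  I (fun x => \sum_i e i x) = \sum_i I (e i).
Proof.
elim: N e => [|N IH] e ce.
  rewrite big_ord0 (_ : (fun x => _) = cst 0) ?Rintegral_cst ?mul0r//.
  by apply/funext => x; rewrite big_ord0.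
rewrite big_ord_recl -IH// -intD//; last by apply: cont_sum => i; exact: ce.
by apply: eq_Rintegral => x _; rewrite big_ord_recl.
Qed.

(** The degenerate case of the Cauchy-Schwarz inequality: [I ((f + t g)^2)] is
    affine in [t] and nonnegative, so its slope vanishes. *)
Lemma Rintegral_mul_eq0 f g : continuous f -> continuous g ->
  I (fun x => g x * g x) = 0 -> I (fun x => f x * g x) = 0.
Proof.
move=> cf cg gg0; apply/eqP/negPn/negP => a0.
set a := Rintegral _ _ _ in a0; pose F := I (fun x => f x * f x).
(* Chosen so that [I ((f + t g)^2) = -1]. *)
pose t := - (F + 1) / (2 * a).
have : 0 <= I (fun x => (f x + t * g x) * (f x + t * g x)).
  by apply: Rintegral_ge0 => x _; rewrite -expr2 sqr_ge0.
rewrite (_ : (fun x => _) = (fun x =>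
    f x * f x + (2 * t * (f x * g x) + t ^+ 2 * (g x * g x)))); last first.
  by apply/funext => x; ring.
have cfg := contM cf cg; have cff := contM cf cf; have cgg := contM cg cg.
rewrite intD ?intZ//; last by apply: contD; exact: contZ.
rewrite intD ?intZ//; [|exact: contZ..].
rewrite gg0 mulr0 addr0 -/F -/a.
rewrite (_ : F + _ = -1); first by rewrite ler0N1.
by rewrite /t; field.
Qed.

(** The normal equations [a *m G = b] of the Gram matrix [G] are solvable even
    if [G] is singular: a column [v] of [cokermx G] gives [g = sum v_i e_i]
    orthogonal to each [e_i], hence to itself, hence to [f]; that is,
    [b *m v = 0]. *)
Lemma orthogonal_projection_exists N (e : 'I_N -> 'rV[R]_n -> R) f :
  (forall i, continuous (e i)) -> continuous f ->
  exists a : 'I_N -> R, forall j,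
    I (fun x => (f x - \sum_i a i * e i x) * e j x) = 0.
Proof.
move=> ce cf.
pose G := \matrix_(i, j) I (fun x => e i x * e j x).
pose b := \row_j I (fun x => f x * e j x).
have cee i j : continuous (fun x => e i x * e j x) by exact: contM.
have cfe j : continuous (fun x => f x * e j x) by exact: contM.
have /submxP[a ba] : (b <= G)%MS.
  rewrite submxE; apply/eqP/matrixP => i0 k; rewrite (ord1 i0) !mxE.
  pose v i := cokermx G i k; pose g x := \sum_i v i * e i x.
  have cve i : continuous (fun x => v i * e i x) by exact: contZ.
  have cg : continuous g by exact: cont_sum.
  have eg i : I (fun x => e i x * g x) = 0.
    have /matrixP/(_ i k) := mulmx_coker G; rewrite !mxE => <-.
    rewrite (_ : (fun x => _) = (fun x => \sum_j v j * (e i x * e j x))).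
      rewrite int_sum => [|j]; last exact: contZ.
      by apply: eq_bigr => j _; rewrite intZ// mulrC mxE.
    by apply/funext => x; rewrite mulr_sumr; apply: eq_bigr => j _; ring.
  have gg : I (fun x => g x * g x) = 0.
    rewrite (_ : (fun x => _) = (fun x => \sum_j v j * (e j x * g x))).
      rewrite int_sum => [|j]; last by apply: contZ; exact: contM.
      by rewrite big1// => j _; rewrite intZ ?eg ?mulr0//; exact: contM.
    by apply/funext => x; rewrite mulr_suml; apply: eq_bigr => j _; ring.
  rewrite -[RHS](Rintegral_mul_eq0 cf cg gg).
  rewrite (_ : (fun x => _) = (fun x => \sum_j v j * (f x * e j x))).
    rewrite int_sum => [|j]; last exact: contZ.
    by apply: eq_bigr => j _; rewrite intZ// mulrC [b _ _]mxE.
  by apply/funext => x; rewrite mulr_sumr; apply: eq_bigr => j _; ring.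
exists (a ord0) => j.
have caee i : continuous (fun x => - a ord0 i * (e i x * e j x)).
  exact: contZ.
rewrite (_ : (fun x => _) =
    (fun x => f x * e j x + \sum_i - a ord0 i * (e i x * e j x))).
  rewrite intD//; last exact: cont_sum.
  rewrite int_sum//; have /rowP/(_ j) := ba; rewrite !mxE => ->.
  rewrite -big_split big1// => i _ /=; rewrite intZ// mxE; ring.
apply/funext => x; rewrite mulrBl mulr_suml -sumrN; congr (_ + _).
by apply: eq_bigr => i _; ring.
Qed.

Let integralE f : continuous f ->
  (\int[mu]_(x in Q) (f x)%:E)%E = (I f)%:E.
Proof.
move=> cf; rewrite fineK//; apply: integrable_fin_num => //.
exact: cont_integrable.
Qed.

Let cont_meval (P : mpoly.mpoly n R) :
  continuous (fun x : 'rV[R]_n => mpoly.meval (x ord0) P).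
Proof. exact: meval_continuous. Qed.

Let contB f g : continuous f -> continuous g -> continuous (fun x => f x - g x).
Proof. by move=> cf cg x; apply: continuousB; [exact: cf|exact: cg]. Qed.

Lemma mmap1_continuous (m : mpoly.multinom n) :
  continuous (fun x : 'rV[R]_n => mpoly.mmap1 (x ord0) m).
Proof.
rewrite (_ : (fun x => _) =
    (fun x : 'rV[R]_n => mpoly.meval (x ord0) (mpoly.mpolyX R m))).
  exact: cont_meval.
by apply/funext => x; rewrite mpoly.mevalX.
Qed.

Lemma poly_projP k f : continuous f -> is_poly_proj k f Q (poly_proj k f Q).
Proof.
move=> cf; suff [P PP] : exists P, is_poly_proj k f Q P.
  by apply: xgetPex; exists P.
pose J : finType := mpoly.bmultinom n k.
pose e (i : 'I_#|J|) := mpoly.bmnm (enum_val i).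
have [a aP] := orthogonal_projection_exists
  (fun i => @mmap1_continuous (e i)) cf.
exists (\sum_i a i *: mpoly.mpolyX R (e i)); split.
  rewrite (leq_trans (mpoly.msize_sum _ _ _))//; apply/bigmax_leqP => i _.
  rewrite (leq_trans (mpoly.msizeZ_le _ _))// mpoly.msizeX.
  exact: mpoly.bmdeg.
move=> zeta zk; pose z : J := mpoly.BMultinom zk.
rewrite integralE; last first.
  by apply: contM; [exact: contB|exact: mmap1_continuous].
congr EFin.
rewrite -[RHS](aP (enum_rank z)) /e enum_rankK.
apply: eq_Rintegral => x _; congr ((_ - _) * _).
rewrite (raddf_sum (mpoly.meval (x ord0))) /=; apply: eq_bigr => i _.
by rewrite mpoly.mevalZ mpoly.mevalX.
Qed.

Lemma poly_proj_orthogonal k f P T : continuous f ->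
  is_poly_proj k f Q P -> (mpoly.msize T <= k)%N ->
  I (fun x => (f x - mpoly.meval (x ord0) P) * mpoly.meval (x ord0) T) = 0.
Proof.
move=> cf [_ PP] Tk.
pose N := size (mpoly.msupp T).
pose m (i : 'I_N) := nth mpoly.mnm0 (mpoly.msupp T) i.
have cfP : continuous (fun x : 'rV[R]_n => f x - mpoly.meval (x ord0) P).
  exact: contB.
have cfPm i : continuous (fun x : 'rV[R]_n =>
    (f x - mpoly.meval (x ord0) P) * mpoly.mmap1 (x ord0) (m i)).
  by apply: contM => //; exact: mmap1_continuous.
rewrite (_ : (fun x => _) = (fun x => \sum_i mpoly.mcoeff (m i) T *
   ((f x - mpoly.meval (x ord0) P) * mpoly.mmap1 (x ord0) (m i)))).
  rewrite int_sum => [|i]; last exact: contZ.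
  rewrite big1// => i _; rewrite intZ//.
  have mk : (mpoly.mdeg (m i) < k)%N.
    by rewrite (leq_trans _ Tk)// mpoly.msize_mdeg_lt// mem_nth.
  by have := PP _ mk; rewrite integralE// => -[->]; rewrite mulr0.
apply/funext => x.
rewrite (mpoly.mevalE _ T) (big_nth mpoly.mnm0) big_mkord mulr_sumr.
by apply: eq_bigr => i _; rewrite -/(m i) /mpoly.mmap1; ring.
Qed.

(** With [h = f - P] and [d = P - T], orthogonality gives
    [I (h^2) <= I ((h + d)^2) <= M^2 |Q|], and [|h| <= h^2 / (2 M) + M / 2]
    plays the part of the Cauchy-Schwarz inequality. *)
Lemma approx_err_le k f T M : continuous f -> (mpoly.msize T <= k)%N ->
  0 < M -> (forall x, Q x -> `|f x - mpoly.meval (x ord0) T| <= M) ->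
  (approx_err k f Q <= (M * s ^+ n)%:E)%E.
Proof.
move=> cf Tk M0 fTM; have PP := poly_projP k cf.
set P := poly_proj k f Q in PP.
have PTk : (mpoly.msize (P - T) <= k)%N.
  rewrite (leq_trans (mpoly.msizeD_le _ _))// geq_max mpoly.msizeN Tk.
  by have [->] := PP.
pose h (x : 'rV[R]_n) := f x - mpoly.meval (x ord0) P.
pose d (x : 'rV[R]_n) := mpoly.meval (x ord0) (P - T).
have ch : continuous h by exact: contB.
have cd : continuous d by exact: cont_meval.
have hd0 : I (fun x => h x * d x) = 0 by exact: poly_proj_orthogonal PP PTk.
have chh := contM ch ch; have cdd := contM cd cd; have chd := contM ch cd.
have c1 (a : R) : continuous (fun _ : 'rV[R]_n => a) by exact: cst_continuous.
have I1 a : I (fun=> a) = a * s ^+ n.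
  by rewrite Rintegral_cst// [X in fine X]lebesgue_cube.
have hh : I (fun x => h x * h x) <= M ^+ 2 * s ^+ n.
  have : I (fun x => h x * h x + (2 * (h x * d x) + d x * d x))
      <= M ^+ 2 * s ^+ n.
    rewrite -I1; apply: le_Rintegral => //.
    - apply: cont_integrable; apply: contD => //.
      by apply: contD => //; exact: contZ.
    - exact: cont_integrable.
    - move=> x Qx; rewrite (_ : _ + _ = (h x + d x) ^+ 2); last by ring.
      rewrite -(real_normK (num_real (h x + d x))).
      rewrite lerXn2r ?nnegrE//; first exact: ltW.
      by rewrite /h /d mpoly.mevalB addrA subrK; exact: fTM.
  rewrite intD//; last by apply: contD => //; exact: contZ.
  rewrite intD//; last exact: contZ.
  rewrite intZ// hd0 mulr0 add0r; apply: le_trans.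
  by rewrite lerDl; apply: Rintegral_ge0 => x _; rewrite -expr2 sqr_ge0.
have cnh : continuous (fun x => `|h x|).
  by move=> x; apply: continuous_comp; [exact: ch|exact: norm_continuous].
rewrite /approx_err integralE// lee_fin.
apply: (@le_trans _ _ (I (fun x => (2 * M)^-1 * (h x * h x) + M / 2))).
  apply: le_Rintegral => //; [exact: cont_integrable| |].
    by apply: cont_integrable; apply: contD => //; exact: contZ.
  move=> x _; rewrite -(ler_pM2l (mulr_gt0 (ltr0Sn R 1) M0)) mulrDr mulrA divff.
    have := sqr_ge0 (`|h x| - M); rewrite -expr2 -(real_normK (num_real (h x))).
    by nra.
  by rewrite mulf_neq0// gt_eqF.
rewrite intD//; last exact: contZ.
rewrite intZ// I1.
rewrite [leRHS](_ : _ = (2 * M)^-1 * (M ^+ 2 * s ^+ n) + M / 2 * s ^+ n).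
  by rewrite lerD2r ler_wpM2l// invr_ge0 mulr_ge0// ltW.
by field; rewrite gt_eqF.
Qed.

End Projection.

(** * Dyadic cubes through a point *)

Section DyadicCubes.
Context (R : realType) (n : nat).
Implicit Types (alpha x y : 'rV[R]_n) (j : int) (m : 'rV[int]_n).

Lemma side_gt0 j : 0 < (2 : R) ^ j. Proof. exact: exprz_gt0. Qed.

Lemma dyadic_cubeP alpha j m x : dyadic_cube alpha j m x <->
  forall i, (m ord0 i)%:~R <= (2 ^ j)^-1 * x ord0 i - (-1) ^ j * alpha ord0 i
    < (m ord0 i)%:~R + 1.
Proof.
have s0 : (2 : R) ^ j != 0 by rewrite gt_eqF// side_gt0.
split=> [[u u01 <-] i|xm].
  by have := u01 i; rewrite !mxE mulKf//; lra.
exists ((2 ^ j)^-1 *: x - map_mx intr m - (-1) ^ j *: alpha).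
  by move=> i; have := xm i; rewrite !mxE; lra.
apply/rowP => i; rewrite !mxE; move: s0; set t := 2 ^ j => s0.
by set e := (-1) ^ j; field.
Qed.

Lemma dyadic_cubeE alpha j m : dyadic_cube alpha j m =
  cube ((2 : R) ^ j *: (map_mx intr m + (-1) ^ j *: alpha)) (2 ^ j).
Proof.
have s0 := side_gt0 j.
have E (a e z : R) : (a <= (2 ^ j)^-1 * z - e < a + 1) =
    (2 ^ j * (a + e) <= z < 2 ^ j * (a + e) + 2 ^ j).
  have -> : 2 ^ j * (a + e) + 2 ^ j = 2 ^ j * (a + e + 1) :> R.
    by rewrite [RHS]mulrDr mulr1.
  by rewrite lerBrDr ltrBlDr ler_pdivlMl// ltr_pdivrMl// addrAC.
by apply/seteqP; split=> y => [/dyadic_cubeP ym i|ym];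
  [|apply/dyadic_cubeP => i]; have := ym i; rewrite !mxE E.
Qed.

Definition dyadic_cube_at alpha j x : set 'rV[R]_n :=
  dyadic_cube alpha j
    (\row_i Num.floor ((2 ^ j)^-1 * x ord0 i - (-1) ^ j * alpha ord0 i)).

Lemma dyadic_cube_at_refl alpha j x : dyadic_cube_at alpha j x x.
Proof.
apply/dyadic_cubeP => i; rewrite mxE floor_le /=.
by set t := _ - _; have := floorD1_gt t; rewrite intrD.
Qed.

Lemma dyadic_cube_atE alpha j m x : dyadic_cube alpha j m x ->
  dyadic_cube alpha j m = dyadic_cube_at alpha j x.
Proof.
move=> /dyadic_cubeP mx; congr dyadic_cube; apply/rowP => i; rewrite mxE.
by apply/esym/floor_def; rewrite intrD.
Qed.

Lemma vol_dyadic_cube_at alpha j x :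
  vol (dyadic_cube_at alpha j x) = (2 ^ j) ^+ n.
Proof.
by rewrite /vol /dyadic_cube_at dyadic_cubeE lebesgue_cube// ltW// side_gt0.
Qed.

Lemma dyadic_cube_at_inj alpha x : (0 < n)%N ->
  injective (fun j => dyadic_cube_at alpha j x).
Proof.
move=> n0 j j' E; have := congr1 (@vol R n) E; rewrite /= !vol_dyadic_cube_at.
move=> /pexpIrn -/(_ n0); rewrite !nnegrE !ltW ?side_gt0//.
by move=> /(_ isT isT); apply: ieexprIz => //; rewrite gt_eqF// ltr1n.
Qed.

(** One coordinate of the nesting, in units of the smaller scale: [X] and [Y]
    are two points, [e] is the shift of the small interval, and the shift of the
    large one is [- e] because [(-1)^j] changes sign. The ends of the large
    interval, [2 m' - 2 e] and [2 m' + 2 - 2 e], lie on the grid [m + e] of the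
    small intervals, as [3 e] is an integer. *)
Lemma dyadic_interval_nested (m m' z : int) (X Y e : R) : 3 * e = z%:~R ->
  m%:~R <= X - e < m%:~R + 1 -> m%:~R <= Y - e < m%:~R + 1 ->
  m'%:~R <= X / 2 + e < m'%:~R + 1 -> m'%:~R <= Y / 2 + e < m'%:~R + 1.
Proof.
move=> ez mX mY mX'.
(* Both intervals contain [X], which bounds [m] by integers. *)
have lo : (2 * m' - z)%:~R < (m + 1)%:~R :> R.
  by rewrite !(intrD, intrM, mulrNz); lra.
have hi : m%:~R < (2 * m' + 2 - z)%:~R :> R.
  by rewrite !(intrD, intrM, mulrNz); lra.
move: lo hi; rewrite !ltr_int => lo hi.
have {}lo : (2 * m' - z)%:~R <= m%:~R :> R by rewrite ler_int; lia.
have {}hi : (m + 1)%:~R <= (2 * m' + 2 - z)%:~R :> R by rewrite ler_int; lia.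
by move: lo hi; rewrite !(intrD, intrM, mulrNz); lra.
Qed.

Lemma dyadic_cube_at_subS alpha j x :
  (forall i, alpha ord0 i \in [:: 0; 1 / 3; 2 / 3]) ->
  dyadic_cube_at alpha j x `<=` dyadic_cube_at alpha (j + 1) x.
Proof.
move=> alphaP y /dyadic_cubeP yj; apply/dyadic_cubeP => i.
have /dyadic_cubeP/(_ i) xj := dyadic_cube_at_refl alpha j x.
have /dyadic_cubeP/(_ i) := dyadic_cube_at_refl alpha (j + 1) x.
have N1 : (-1 : R) != 0 by rewrite oppr_eq0 oner_eq0.
have -> : (-1 : R) ^ (j + 1) = - (-1) ^ j by rewrite expfzDr// expr1z mulrN1.
have -> : ((2 : R) ^ (j + 1))^-1 = (2 ^ j)^-1 / 2.
  by rewrite expfzDr// expr1z invfM.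
rewrite !mulNr !opprK ![_ / 2 * _]mulrAC.
have [z ez] : exists z : int, 3 * ((-1) ^ j * alpha ord0 i) = z%:~R.
  have [t ta] : exists t : int, 3 * alpha ord0 i = t%:~R.
    have := alphaP i; rewrite !inE => /or3P[] /eqP ->.
    - by exists 0; rewrite mulr0.
    - by exists 1; rewrite mulrCA divff ?mulr1.
    - by exists 2; rewrite mulrCA divff ?mulr1.
  have : ((-1 : R) ^ j == 1) || ((-1 : R) ^ j == -1).
    by rewrite -sqrf_eq1 expr2 -expfzMl mulrNN mulr1 exp1rz.
  case/orP => /eqP ->.
  - by exists t; rewrite mul1r.
  - by exists (- t); rewrite mulN1r mulrN ta mulrNz.
exact: dyadic_interval_nested ez xj (yj i).
Qed.

Lemma dyadic_cube_at_mono alpha j j' x :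
  (forall i, alpha ord0 i \in [:: 0; 1 / 3; 2 / 3]) -> j <= j' ->
  dyadic_cube_at alpha j x `<=` dyadic_cube_at alpha j' x.
Proof.
move=> alphaP jj'; rewrite -(subrK j j') addrC.
have -> : j' - j = `|j' - j|%N by lia.
elim: `|j' - j|%N => [|k IH]; first by rewrite addr0.
apply: subset_trans IH _; have -> : j + k.+1%:Z = j + k%:Z + 1 by lia.
exact: dyadic_cube_at_subS.
Qed.

End DyadicCubes.

(** * Extremal scales and geometric sums *)

Lemma int_max_exists (P : int -> Prop) (j0 b : int) :
  P j0 -> (forall j, P j -> j <= b) ->
  exists2 j1, P j1 & forall j, P j -> j <= j1.
Proof.
move=> Pj0 Pb.
have Pex : exists k : nat, `[< P (b - k%:Z) >].
  exists `|b - j0|%N; apply/asboolP.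
  by rewrite gez0_abs ?subr_ge0 ?Pb// opprB addrC subrK.
have [k /asboolP Pk kmin] := ex_minnP Pex.
exists (b - k%:Z) => // j Pj.
have := kmin `|b - j|%N; rewrite gez0_abs ?subr_ge0 ?Pb//.
rewrite (_ : b - (b - j) = j); last by lia.
move=> /(_ (asboolT Pj)); have := Pb _ Pj; lia.
Qed.

Section GeometricSums.
Context (R : realType).

(** Some of the terms of the geometric sequence may be missing from [D]; only an
    upper bound can be expected. *)
Lemma esum_geometric_le (T : choiceType) (D : set T) (F : nat -> T)
    (g : T -> \bar R) (a r : R) : 0 <= a -> 0 < r < 1 -> injective F ->
  (forall t, D t -> ~ range F t -> g t = 0%E) ->
  (forall k, D (F k) -> g (F k) = (a * r ^+ k)%:E) ->
  (\esum_(t in D) g t <= (a * (1 - r)^-1)%:E)%E.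
Proof.
move=> a0 /andP[r0 r1] F_inj gD gF.
rewrite (@eq_esum _ _ D _ (fun t =>
    if t \in range F then g t else 0%E)); last first.
  by move=> t Dt; case: ifPn => // /negP; rewrite inE; exact: gD.
rewrite -esum_mkcondr (_ : D `&` range F = F @` (F @^-1` D)); last first.
  apply/seteqP; split=> [t [Dt [k _ kt]]|_ [k Dk <-]]; last first.
    by split => //; exists k.
  by exists k => //=; rewrite kt.
rewrite esum_image; last by move=> i j _ _; exact: F_inj.
rewrite esum_mkcond.
apply: (@le_trans _ _ (\esum_(k in [set: nat]) (geometric a r k)%:E)).
  apply: le_esum => k _; case: ifPn => [|_]; first by rewrite inE => /gF ->.
  by rewrite lee_fin geometric_ge0// ltW.
have g0 k : (0 <= (geometric a r k)%:E)%E.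
  by rewrite lee_fin geometric_ge0// ltW.
rewrite -nneseries_esumT//; apply: lime_le.
  by apply: is_cvg_nneseries => k _ _.
apply: nearW => k; rewrite sumEFin lee_fin.
by apply: geometric_le_lim => //; rewrite gtr0_norm.
Qed.

End GeometricSums.

(** * Bad cubes *)

Section BadCubes.
Context (R : realType) (n : nat).
Implicit Types (alpha x : 'rV[R]_n) (f : 'rV[R]_n -> R) (j : int).

Lemma cube_dist (c x y : 'rV[R]_n) s i : cube c s x -> cube c s y ->
  `|y ord0 i - x ord0 i| <= s.
Proof. by move=> /(_ i) + /(_ i); rewrite ler_norml; lra. Qed.

(** The Taylor polynomial at [x] is a competitor of degree [< l <= k], within
    [C * (2 ^ j) ^+ l] of [f] on the cube of side [2 ^ j]. *)
Lemma approx_err_dyadic_le f (l : nat) : smooth f ->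
  continuous_compact_support (grad_norm l f) ->
  exists2 C : R, 0 < C & forall k alpha j x, (l <= k)%N ->
    (approx_err k f (dyadic_cube_at alpha j x)
      <= (C * (2 ^ j) ^+ l * (2 ^ j) ^+ n)%:E)%E.
Proof.
move=> sf sgrad; have [C C0 CP] := taylor_smooth sf sgrad.
exists (C + 1) => [|k alpha j x lk]; first by rewrite ltr_wpDl.
have [T Tl TP] := CP x; have s0 := side_gt0 R j.
have := dyadic_cube_at_refl alpha j x.
rewrite /dyadic_cube_at dyadic_cubeE => xQ.
apply: (@approx_err_le _ _ _ _ (ltW s0) _ _ T).
- by have [] := sf [::].
- exact: leq_trans lk.
- by rewrite mulr_gt0 ?exprn_gt0// ltr_wpDl.
move=> y Qy; rewrite (le_trans (TP y _ (ltW s0) _))//.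
  by move=> i; exact: cube_dist xQ Qy.
by rewrite ler_wpM2r ?exprn_ge0 ?(ltW s0)// lerDl.
Qed.

Lemma powR_dyadic j (a : R) : (2 ^ j) `^ a = 2 `^ (j%:~R * a).
Proof. by rewrite -powR_intmul// -powRrM. Qed.

Lemma powR_mulX (z a b : R) (q : nat) : 0 < z ->
  z `^ a * (z `^ b) ^+ q = z `^ (a + b * q%:R).
Proof.
move=> z0; rewrite powRD; last by apply/implyP => _; rewrite gt_eqF.
by rewrite powRrM powR_mulrn// powR_ge0.
Qed.

Lemma vol_dyadic_powR alpha j x (a : R) :
  vol (dyadic_cube_at alpha j x) `^ a = 2 `^ (j%:~R * (n%:R * a)).
Proof.
rewrite vol_dyadic_cube_at -powR_mulrn ?(ltW (side_gt0 R j))// -powRrM.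
exact: powR_dyadic.
Qed.

(** For a cube of side [t = 2 ^ j] the definition of badness and the error bound
    give [lambda * t^(n beta + l) < C * t^(n + l)]; this is the logarithm of the
    resulting bound on [t^(n (beta - 1))]. *)
Lemma bad_dyadic_scale_bound f (l : nat) (lambda beta : R) : (0 < n)%N ->
  0 < lambda -> smooth f -> continuous_compact_support (grad_norm l f) ->
  exists B : R, forall k alpha j x, (l <= k)%N ->
    bad_dyadic alpha lambda beta k l f (dyadic_cube_at alpha j x) ->
    j%:~R * (n%:R * (beta - 1)) <= B.
Proof.
move=> n0 lambda0 sf sgrad; have [C C0 CP] := approx_err_dyadic_le sf sgrad.
exists (ln (C / lambda) / ln 2) => k alpha j x lk [_].
move=> /lt_le_trans/(_ (CP k alpha j x lk)); rewrite lte_fin vol_dyadic_powR.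
have n0' : n%:R != 0 :> R by rewrite pnatr_eq0 -lt0n.
have -> : j%:~R * (n%:R * (beta + l%:R / n%:R)) =
    j%:~R * (n%:R * (beta - 1)) + j%:~R * l%:R + j%:~R * n%:R :> R by field.
have ln2 : 0 < ln 2 :> R by rewrite ln_gt0// ltr1n.
rewrite !powRD ?pnatr_eq0 ?implybT//.
have E (q : nat) : 2 `^ (j%:~R * q%:R) = (2 ^ j) ^+ q :> R.
  by rewrite -powR_dyadic powR_mulrn// ltW// side_gt0.
rewrite !E !mulrA ltr_pM2r ?ltr_pM2r ?exprn_gt0 ?side_gt0//.
rewrite mulrC -ltr_pdivlMr// => H.
rewrite ler_pdivlMr// -ln_powR ler_ln ?posrE ?powR_gt0 ?divr_gt0//.
exact: ltW.
Qed.

End BadCubes.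

Theorem lemma3p9 (R : realType) (n : nat) (hn : (0 < n)%N) (p beta : R)
    (hp : 0 < p) (hbeta : beta <> 1) :
  exists c1 c2 : R, 0 < c1 /\ 0 < c2 /\
  forall (alpha : 'rV[R]_n)
    (halpha : forall i, alpha ord0 i \in [:: 0; 1 / 3; 2 / 3])
    (k l : nat) (hl : (0 < l)%N) (hlk : (l <= k)%N)
    (lambda : R) (hlambda : 0 < lambda)
    (f : 'rV[R]_n -> R) (hf : smooth f)
    (hgrad : continuous_compact_support (grad_norm l f))
    (x : 'rV[R]_n) (hx : bad_set alpha lambda beta k l f x),
  exists! Qx : set 'rV[R]_n,
    [/\ bad_dyadic alpha lambda beta k l f Qx, Qx x,
        extremal_cube beta (bad_dyadic alpha lambda beta k l f) x Qx
      & equiv_up_to c1 c2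
          (\esum_(Q in bad_dyadic alpha lambda beta k l f)
             (vol Q `^ (p * (beta - 1)) * \1_Q x)%:E)
          (vol Qx `^ (p * (beta - 1)))%:E].
Proof.
(* Reversing the scales if [beta < 1] reduces both cases to the search of a
   largest scale [i1]; the chain is then indexed by [sg * i]. *)
pose sg : int := if 1 < beta then 1 else -1.
have sg2 : sg * sg = 1 by rewrite /sg; case: ifP.
have hbeta' : 1 < beta \/ beta < 1.
  by case: (ltgtP beta 1) => b1; [right|left|case: hbeta].
pose e : R := n%:R * `|beta - 1|.
have e0 : 0 < e.
  by rewrite mulr_gt0 ?ltr0n// normr_gt0 subr_eq0; exact/eqP.
have sge : n%:R * (beta - 1) = sg%:~R * e :> R.
  rewrite /e /sg; case: hbeta' => b1.
    by rewrite b1 mul1r gtr0_norm// subr_gt0.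
  by rewrite lt_gtF// mulN1r ltr0_norm ?subr_lt0// mulrN opprK.
pose r : R := 2 `^ (- (e * p)).
have r01 : 0 < r < 1.
  rewrite powR_gt0// /r /powR pnatr_eq0 /= expR_lt1 mulNr oppr_lt0.
  by rewrite mulr_gt0 ?ln_gt0 ?ltr1n// mulr_gt0.
have [r0 r1] := andP r01.
exists (1 - r), 1; split; [by rewrite subr_gt0|split=> //].
move=> alpha alphaP k l _ lk lambda lambda0 f sf sgrad x [Q0 DDQ0 Q0x].
set DD := bad_dyadic _ _ _ _ _ _.
pose At j := dyadic_cube_at alpha j x.
have AtP Q' : DD Q' -> Q' x -> exists2 j, Q' = At j & DD (At j).
  move=> DDQ Q'x; have [[j [m' Q'E]] _] := DDQ.
  have Q'j : Q' = At j.
    by rewrite Q'E; apply: dyadic_cube_atE; rewrite -Q'E.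
  by exists j; rewrite -?Q'j.
have [B BP] := bad_dyadic_scale_bound beta hn lambda0 sf sgrad.
have [i1 DDi1 i1max] : exists2 i, DD (At (sg * i)) &
    forall i', DD (At (sg * i')) -> i' <= i.
  have [j00 _ DDj] := AtP _ DDQ0 Q0x.
  apply: (@int_max_exists _ (sg * j00) (Num.ceil (B / e))).
    by rewrite mulrA sg2 mul1r.
  move=> i /(BP _ _ _ _ lk); rewrite sge mulrA -intrM mulrAC sg2 mul1r.
  rewrite -ler_pdivlMr// -(@ler_int R) => /le_trans; apply.
  exact: ceil_ge.
have DDle j : DD (At j) -> sg * j <= i1.
  by move=> DDj; apply: i1max; rewrite mulrA sg2 mul1r.
have extr : extremal_cube beta DD x (At (sg * i1)).
  split=> b1 Q' DDQ /(AtP _ DDQ)[j -> /DDle]; rewrite /sg.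
    by rewrite b1 !mul1r => ?; exact: dyadic_cube_at_mono.
  by rewrite lt_gtF// => ?; apply: dyadic_cube_at_mono => //; lia.
(* The weights grow with [i] in both cases, since [sg * (beta - 1) > 0]. *)
have volE (i : int) :
    vol (At (sg * i)) `^ (p * (beta - 1)) = 2 `^ (i%:~R * (e * p)).
  rewrite vol_dyadic_powR; congr (_ `^ _).
  have -> : n%:R * (p * (beta - 1)) = p * (sg%:~R * e) by rewrite -sge mulrCA.
  have sgsg : sg%:~R * sg%:~R = 1 :> R by rewrite -intrM sg2.
  transitivity (sg%:~R * sg%:~R * (i%:~R * (e * p))).
    by rewrite intrM; ring.
  by rewrite sgsg mul1r.
exists (At (sg * i1)); split.
  split => //; first exact: dyadic_cube_at_refl.
  split; last first.
    rewrite mul1e; apply: esum_ge; exists [set At (sg * i1)].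
      by split => [|_ -> //]; exact: finite_set1.
    rewrite fsbig_set1 indicE mem_set ?mulr1//; exact: dyadic_cube_at_refl.
  have c0 : 0 < 1 - r by rewrite subr_gt0.
  rewrite -lee_pdivlMl// -EFinM [(1 - r)^-1 * _]mulrC.
  apply: (esum_geometric_le (F := fun q : nat => At (sg * (i1 - q%:Z)))) => //.
  - exact: powR_ge0.
  - move=> q q' /(dyadic_cube_at_inj hn) /(congr1 ( *%R sg)).
    rewrite !mulrA sg2; lia.
  - move=> Q' DDQ; rewrite indicE.
    case: (boolP (x \in Q')) => [|_ _]; last by rewrite mulr0.
    rewrite inE => /(AtP _ DDQ)[j -> /DDle ji] [].
    exists `|(i1 - sg * j)%R|%N => //.
    rewrite gez0_abs ?subr_ge0// opprB addrC subrK.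
    by rewrite mulrA sg2 mul1r.
  - move=> q _; rewrite indicE mem_set; last exact: dyadic_cube_at_refl.
    rewrite [X in X%:E = _]mulr1 (volE i1) (volE (i1 - q%:Z)).
    by rewrite (powR_mulX _ _ _ (ltr0Sn R 1)) intrB; congr (_ `^ _)%:E; ring.
move=> Q' [DDQ Q'x [ext1 ext2] _]; have [xt1 xt2] := extr.
have At_x := dyadic_cube_at_refl alpha (sg * i1) x.
case: hbeta' => b1; apply/seteqP; split.
- exact: ext1 b1 _ DDi1 At_x.
- exact: xt1 b1 _ DDQ Q'x.
- exact: xt2 b1 _ DDQ Q'x.
- exact: ext2 b1 _ DDi1 At_x.
Qed.
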